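(* For every $1\le k\le n$, there exists a unique $G(r,n)$-invariant polynomial $U_k\in\mathbb{C}[x_1,\dots,x_n]$, homogeneous of degree $rk$, such that $\mathcal D_d\,U_k=\delta_{d,k}$ for every $1\le d\le n$. It is given explicitly by $$U_k(x)=\sum_{\lambda\vdash k}(-1)^{l(\lambda)-1}\,\frac{(l(\lambda)-1)!}{\prod_{h=1}^{k}m_h!}\;\widetilde E_\lambda(x),$$ where the sum runs over all partitions $\lambda$ of $k$, $l(\lambda)$ is the number of parts of $\lambda$ and $m_h$ is the multiplicity of the part $h$ in $\lambda$.
   Context: Let $n\ge1$, $r\ge1$ be integers, $\mathbb{N}_n=\{1,\dots,n\}$, $\mu_r$ the group of $r$-th roots of unity in $\mathbb{C}$, and $G(r,n)=\mu_r^n\rtimes S_n$ acting on $\mathbb{C}^n$ by $(\zeta_1,\dots,\zeta_n;\sigma)\cdot(x_1,\dots,x_n)=(\zeta_1x_{\sigma^{-1}(1)},\dots,\zeta_nx_{\sigma^{-1}(n)})$. A function $\phi$ is $G(r,n)$-invariant if $\phi(g\cdot x)=\phi(x)$ for all $g\in G(r,n)$ and all $x$. Let $E_h(x)=e_h(x_1^r,\dots,x_n^r)$ with $e_h$ the $h$-th elementary symmetric function ($E_0=1$), $\widetilde E_h=\frac{(n-h)!}{n!}E_h$ for $0\le h\le n$, and for a partition $\lambda$ with multiplicities $m_h$ let $\widetilde E_\lambda=\prod_h\widetilde E_h^{\,m_h}$. Let $\Delta_i=\frac{1}{r\,x_i^{r-1}}\partial_{x_i}$. For nonempty $I\subseteq\mathbb{N}_n$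 let $$\mathcal D_I=\sum_{i\in I}\frac{1}{\prod_{j\in I,\,j\ne i}(x_j^r-x_i^r)}\,\Delta_i,$$ and for $1\le d\le n$ let $\mathcal D_d=d!\sum_{I\subseteq\mathbb{N}_n,\,|I|=d}\mathcal D_I$. These are differential operators with rational coefficients; identities such as $\mathcal D_dU_k=\delta_{d,k}$ are identities of rational functions. *)

(* Defs.v *)
From HB Require Import structures.
From mathcomp Require Import all_boot all_order all_algebra all_fingroup.
From mathcomp Require Import reals complex mpoly.

Set Implicit Arguments.
Unset Strict Implicit.
Unset Printing Implicit Defensive.

Import Order.TTheory GRing.Theory Num.Theory.
Local Open Scope ring_scope.

(* The complex field is C = R[i] for an arbitrary R : realType.  The index set *)
(* {1, ..., n} is 'I_n, so the variable x_i of the mathematics is 'X_(i-1).    *)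

(* sumn s = k with nonincreasing positive entries. *)
Definition is_partition (k : nat) (s : seq nat) : bool :=
  [&& sorted geq s, 0%N \notin s & sumn s == k].

Section Operators.
Variables (R : realType) (n r : nat).
Local Notation C := R[i].
Local Notation poly_n := {mpoly C[n]}.
Local Notation rat_n := {fraction {mpoly C[n]}}.

Definition Grn_act (z : 'I_n -> C) (s : 'S_n) (x : 'I_n -> C) : 'I_n -> C :=
  fun i => z i * x ((s^-1)%g i).

Definition Grn_invariant (p : poly_n) : Prop :=
  forall (z : 'I_n -> C) (s : 'S_n), (forall i, r.-unity_root (z i)) ->
  forall x : 'I_n -> C, p.@[Grn_act z s x] = p.@[x].

Definition E (h : nat) : poly_n :=
  mesym n C h \mPo [tuple 'X_i ^+ r | i < n].

(* n - h is a truncated subtraction: only meaningful for h <= n. *)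
Definition Etilde (h : nat) : poly_n := ((n - h)%N`!%:R / n`!%:R : C) *: E h.

(* The product over h of Etilde_h ^ m_h, taken over the possible part sizes of *)
(* a partition of k; m_h is the multiplicity of h in s.                        *)
Definition Etilde_part (k : nat) (s : seq nat) : poly_n :=
  \prod_(1 <= h < k.+1) Etilde h ^+ count_mem h s.

Definition Delta (i : 'I_n) (p : poly_n) : rat_n :=
  tofrac (p^`M(i)) / tofrac (r%:R * 'X_i ^+ r.-1).

Definition D_set (I : {set 'I_n}) (p : poly_n) : rat_n :=
  \sum_(i in I)
     (\prod_(j in I | j != i) tofrac ('X_j ^+ r - 'X_i ^+ r))^-1 * Delta i p.

Definition D_op (d : nat) (p : poly_n) : rat_n :=
  d`!%:R * \sum_(I : {set 'I_n} | #|I| == d) D_set I p.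

Definition is_U (k : nat) (p : poly_n) : Prop :=
  [/\ Grn_invariant p,
      p \is (r * k)%N.-homog &
      forall d : nat, (1 <= d <= n)%N -> D_op d p = (d == k)%:R].

(* A partition of k has at most k parts, each at most k, so the partitions of  *)
(* k are the sequences satisfying is_partition k in the finite type of         *)
(* sequences of length at most k over {0, ..., k}.                             *)
Definition U_formula (k : nat) : poly_n :=
  \sum_(l : k.-bseq 'I_k.+1 | is_partition k (map val l))
     ((-1) ^+ (size l).-1 * (size l).-1`!%:R
        / \prod_(1 <= h < k.+1) (count_mem h (map val l))`!%:R : C)
     *: Etilde_part k (map val l).

End Operators.

(* Main.v *)
(* With y_i = x_i^r one has Delta_i = d/dy_i, and E_h is the coefficient of t^h *)
(* in prod_j (1 + y_j t).  Lagrange interpolation gives                        *)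
(* D_I E_h = e_(h-d)(y_j : j not in I) for d = #|I|, hence                     *)
(* D_d Etilde_h = Etilde_(h-d).  Writing F(t) = sum_h Etilde_h t^h, U_k is the *)
(* coefficient of t^k in log F, and the derivation D_d sends log F to          *)
(* F^-1 (t^d F) = t^d modulo t^(n+1).                                          *)
(* For uniqueness: the matrix (D_d Etilde_h) is unitriangular, so the D_d span *)
(* the same space of derivations as the Delta_i, and a polynomial killed by    *)
(* all of them is constant.                                                    *)

Require Import Defs.
From HB Require Import structures.
From mathcomp Require Import all_boot all_order all_algebra all_fingroup.
From mathcomp Require Import reals complex mpoly.
From mathcomp Require Import fraction zify ring.

Set Implicit Arguments.
Unset Strict Implicit.
Unset Printing Implicit Defensive.

Import Order.TTheory GRing.Theory Num.Theory.
Local Open Scope ring_scope.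

(** * Sums over partitions *)

(** The D_d are derivations ([D_opM]), and by [D_op_Etilde] each lowers the index of Etilde by d,
    that is, multiplies the generating series F by t^d. This rests on [lagrange_prod_lin], which
    collapses a sum over I to a power of t, and on the count in [sum_coef_prod_linC]. The explicit
    formula expands log F over partitions, just as [inv_coef] expands F^-1. Removing a marked part
    ([sum_parts_marked]) replaces power series calculus: it gives both F F^-1 = 1 ([conv_inv_coef])
    and the logarithmic derivative ([log_coef_deriv]). For uniqueness, the difference of two
    solutions is killed by every Delta_i ([D_op_eq0_Delta]), and homogeneity of positive degree then
    forces it to be zero ([homog_mderiv_eq0]). *)

Definition parts (k : nat) : seq (seq nat) :=
  [seq map val l | l : k.-bseq 'I_k.+1 <- enum {: k.-bseq 'I_k.+1}
                 & is_partition k (map val l)].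

Lemma is_partition_sumn k s : is_partition k s -> sumn s = k.
Proof. by case/and3P=> _ _ /eqP. Qed.

Lemma is_partition_sorted k s : is_partition k s -> sorted geq s.
Proof. by case/and3P. Qed.

Lemma is_partition_mem k s x : is_partition k s -> x \in s -> (0 < x <= k)%N.
Proof.
case/and3P=> _ s0 /eqP <- xs; rewrite lt0n (memPn s0) //=.
by rewrite (perm_sumn (perm_to_rem xs)) /= leq_addr.
Qed.

Lemma size_leq_sumn s : 0%N \notin s -> (size s <= sumn s)%N.
Proof.
elim: s => //= x s IH; rewrite inE negb_or => /andP[x0 /IH].
by move: x0; lia.
Qed.

Lemma mem_parts k s : (s \in parts k) = is_partition k s.
Proof.
apply/mapP/idP => [[l] | ps]; first by rewrite mem_filter => /andP[? _] ->.
have sk : (size (map (@inord k) s) <= k)%N.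
  rewrite size_map -(is_partition_sumn ps) size_leq_sumn //.
  by case/and3P: ps.
have Es : s = map val (Bseq sk : seq _).
  rewrite /= -map_comp -[LHS]map_id; apply/eq_in_map => x /(is_partition_mem ps).
  by case/andP=> _ xk /=; rewrite inordK.
by exists (Bseq sk) => //; rewrite mem_filter mem_enum -Es ps.
Qed.

Lemma parts_uniq k : uniq (parts k).
Proof.
rewrite map_inj_uniq; first by apply: filter_uniq; exact: enum_uniq.
move=> l1 l2 E; by apply/val_inj/(inj_map val_inj).
Qed.

Lemma parts0 : parts 0 = [:: [::]].
Proof.
apply/perm_small_eq => //; apply: uniq_perm; rewrite ?parts_uniq // => s.
rewrite mem_parts inE; apply/idP/eqP => [|-> //].
case: s => // x s ps; have := is_partition_mem ps (mem_head x s).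
by rewrite leqn0; case: x ps.
Qed.

Lemma geq_trans : transitive geq.
Proof. by move=> y x z /= yx zy; apply: leq_trans zy yx. Qed.

Lemma geq_anti : antisymmetric geq.
Proof. by move=> x y; rewrite /geq /= andbC -eqn_leq => /eqP. Qed.

Lemma geq_total : total geq.
Proof. by move=> x y; rewrite /geq /= leq_total. Qed.

(** Inserting [h] and sorting inverts the removal, since a nonincreasing sequence is determined by
    its multiset of entries. *)
Lemma perm_parts_rem k h : (0 < h <= k)%N ->
  perm_eq [seq rem h s | s <- parts k & h \in s] (parts (k - h)).
Proof.
case/andP=> h0 hk; apply: uniq_perm.
- rewrite map_inj_in_uniq ?filter_uniq ?parts_uniq // => s t.
  rewrite !mem_filter !mem_parts => /andP[hs ps] /andP[ht pt] E.
  apply: (sorted_eq geq_trans geq_anti (is_partition_sorted ps) (is_partition_sorted pt)).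
  by rewrite (permPl (perm_to_rem hs)) E perm_sym (perm_to_rem ht).
- exact: parts_uniq.
move=> t; rewrite mem_parts; apply/mapP/idP => [[s]|pt].
  rewrite mem_filter mem_parts => /andP[hs ps] ->.
  case/and3P: (ps) => so s0 /eqP sk; apply/and3P; split.
  - exact: (subseq_sorted geq_trans (rem_subseq h s)).
  - by apply: contra s0 => /mem_rem.
  - by rewrite -sk (perm_sumn (perm_to_rem hs)) /= addKn.
have ps : perm_eq (sort geq (h :: t)) (h :: t) by rewrite perm_sort.
have hs : h \in sort geq (h :: t) by rewrite mem_sort mem_head.
have so := sort_sorted geq_total (h :: t).
exists (sort geq (h :: t)).
  rewrite mem_filter hs mem_parts /=; apply/and3P; split => //.
    rewrite mem_sort inE negb_or eq_sym -lt0n h0 /=.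
    by case/and3P: pt.
  by rewrite (perm_sumn ps) /= (is_partition_sumn pt) subnKC.
apply: (sorted_eq geq_trans geq_anti (is_partition_sorted pt)).
  exact: (subseq_sorted geq_trans (rem_subseq h _)).
by rewrite -(perm_cons h) perm_sym -(permPr ps) perm_sym perm_to_rem.
Qed.

Lemma sum_parts_rem (V : nmodType) k h (F : seq nat -> V) : (0 < h)%N ->
  \sum_(s <- parts k | h \in s) F (rem h s) =
    if (h <= k)%N then \sum_(s <- parts (k - h)) F s else 0.
Proof.
move=> h0; case: leqP => hk.
  by rewrite -(perm_big _ (@perm_parts_rem k h _)) ?h0 //= big_map big_filter.
rewrite big_seq_cond big1 // => s /andP[]; rewrite mem_parts => ps /(is_partition_mem ps).
by case/andP=> _; rewrite leqNgt hk.
Qed.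

Lemma big_seq_count (V : Type) (idx : V) (op : Monoid.com_law idx) (G : nat -> V) k s :
  (forall x, x \in s -> (0 < x <= k)%N) ->
  \big[op/idx]_(x <- s) G x =
    \big[op/idx]_(1 <= h < k.+1) iter (count_mem h s) (op (G h)) idx.
Proof.
elim: s => [|x s IH] sk; first by rewrite big_nil big1.
rewrite big_cons IH => [|y ys]; last by apply: sk; rewrite inE ys orbT.
have xi : x \in index_iota 1 k.+1 by rewrite mem_index_iota sk ?mem_head.
rewrite !(bigD1_seq x xi (iota_uniq _ _)) /= eqxx add1n iterS Monoid.mulmA.
by congr (op _ _); apply: eq_bigr => i; rewrite eq_sym => /negbTE ->.
Qed.

(** * Inverse and logarithm of a power series as partition sums *)

Section PartitionSums.
Variables (K : fieldType) (k : nat).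
Hypothesis charK : [pchar K] =i pred0.

(** The bound is the fixed [k], so that one function serves the partitions of every j <= k; absent
    parts contribute 0! = 1. *)
Definition multfact (s : seq nat) : K :=
  \prod_(1 <= h < k.+1) (count_mem h s)`!%:R.

Lemma natrK_neq0 m : (0 < m)%N -> m%:R != 0 :> K.
Proof. by move=> m0; move/pcharf0P: charK => ->; rewrite -lt0n. Qed.

Lemma multfact_rem h s : (0 < h <= k)%N -> h \in s ->
  multfact s = (count_mem h s)%:R * multfact (rem h s).
Proof.
move=> hk hs; have hi : h \in index_iota 1 k.+1 by rewrite mem_index_iota.
rewrite /multfact !(bigD1_seq h hi (iota_uniq _ _)) /= mulrA; congr (_ * _).
  rewrite -natrM count_rem hs /= eqxx.
  have : (0 < count_mem h s)%N by rewrite -has_count has_pred1.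
  by case: (count_mem h s) => // m _; rewrite subn1 factS.
apply: eq_bigr => i ih; rewrite count_rem /= eq_sym (negbTE ih) andbF subn0 //.
Qed.

Lemma sum_seq_count (G : nat -> K) s : (forall x, x \in s -> (0 < x <= k)%N) ->
  \sum_(x <- s) G x = \sum_(1 <= h < k.+1) (count_mem h s)%:R * G h.
Proof.
move=> sk; rewrite (big_seq_count _ _ sk).
by apply: eq_bigr => h _; rewrite iter_addr_0 mulr_natl.
Qed.

(* Marking one part x of a partition s cancels one factor m_x of the           *)
(* denominator, and removing it leaves an arbitrary partition of j - x.        *)
Lemma sum_parts_marked (G : nat -> seq nat -> K) j : (j <= k)%N ->
  \sum_(s <- parts j) (multfact s)^-1 * (\sum_(x <- s) G x (rem x s)) =
  \sum_(1 <= h < j.+1) \sum_(s <- parts (j - h)) (multfact s)^-1 * G h s.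
Proof.
move=> jk.
transitivity (\sum_(1 <= h < k.+1) \sum_(s <- parts j | h \in s)
    (multfact (rem h s))^-1 * G h (rem h s)).
  under [RHS]eq_bigr do rewrite big_mkcond.
  rewrite exchange_big /=; apply: eq_big_seq => s.
  rewrite mem_parts => ps.
  rewrite (sum_seq_count (fun x => G x (rem x s))) => [|x /(is_partition_mem ps)]; last first.
    by case/andP=> -> /leq_trans ->.
  rewrite big_distrr /=; apply: eq_big_nat => h hk.
  case: ifP => hs; last first.
    by rewrite (count_memPn _) ?hs // mul0r mulr0.
  have c0 : (count_mem h s)%:R != 0 :> K by rewrite natrK_neq0 // -has_count has_pred1.
  rewrite (multfact_rem hk hs) mulrA; congr (_ * _).
  by rewrite invfM mulrC mulrA mulfV // mul1r.
rewrite (@big_cat_nat _ _ _ j.+1) //= [X in _ + X]big_nat [X in _ + X]big1 ?addr0.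
  apply: eq_big_nat => h /andP[h0 hj].
  by rewrite (sum_parts_rem _ (fun t => (multfact t)^-1 * G h t)) // -ltnS hj.
move=> h /andP[jh _].
by rewrite (sum_parts_rem _ (fun t => (multfact t)^-1 * G h t))
  ?ifN -?ltnNge ?(leq_trans _ jh).
Qed.

Variable a : nat -> K.
Hypothesis a0 : a 0%N = 1.

Local Notation mon s := (\prod_(h <- s) a h).

(* For j <= k, the coefficient of t^j in 1 / (sum_h a_h t^h). *)
Definition inv_coef (j : nat) : K :=
  \sum_(s <- parts j) (multfact s)^-1 * ((-1) ^+ size s * (size s)`!%:R * mon s).

Lemma inv_coef0 : inv_coef 0 = 1.
Proof.
rewrite /inv_coef parts0 big_seq1 /= big_nil expr0 fact0 !mulr1.
by rewrite /multfact big1 ?invr1.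
Qed.

(** For l >= 1 parts, l! is the sum of (l-1)! over the parts; marking a part h splits off - a_h and
    leaves a term of [inv_coef (j - h)]. *)
Lemma inv_coef_rec j : (0 < j <= k)%N ->
  inv_coef j = - \sum_(1 <= h < j.+1) a h * inv_coef (j - h).
Proof.
case/andP=> j0 jk.
pose G h s := - (a h * ((-1) ^+ size s * (size s)`!%:R * mon s)).
transitivity (\sum_(s <- parts j) (multfact s)^-1 * (\sum_(x <- s) G x (rem x s))).
  apply: eq_big_seq => s.
  rewrite mem_parts => ps; congr (_ * _).
  transitivity (\sum_(x <- s) (-1) ^+ size s * (size s).-1`!%:R * mon s).
    rewrite big_const_seq count_predT iter_addr_0 -mulr_natl.
    have : (0 < size s)%N.
      by case: s ps => // /is_partition_sumn /= E; rewrite -E in j0.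
    case: (size s) => // l _; rewrite factS natrM /=; ring.
  apply: eq_big_seq => x xs.
  have ms : mon s = a x * mon (rem x s).
    by rewrite (perm_big _ (perm_to_rem xs)) /= big_cons.
  rewrite /G size_rem // ms.
  have : (0 < size s)%N by case: (s) xs.
  case: (size s) => // l _; rewrite exprS /=; ring.
rewrite sum_parts_marked // -sumrN; apply: eq_bigr => h _.
rewrite /inv_coef big_distrr -sumrN; apply: eq_bigr => s _ /=; rewrite /G; ring.
Qed.

Lemma conv_inv_coef j : (j <= k)%N ->
  \sum_(0 <= h < j.+1) a h * inv_coef (j - h) = (j == 0%N)%:R.
Proof.
move=> jk; rewrite big_nat_recl // a0 mul1r subn0.
case: (posnP j) => [->|j0]; first by rewrite big_geq // inv_coef0 addr0.
rewrite inv_coef_rec ?j0 //.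
by rewrite -(big_add1 _ _ 0 j.+1 xpredT (fun h => a h * inv_coef (j - h))) addNr.
Qed.

(* The logarithmic derivative F^-1 (D F) of F = sum_h a_h t^h is t^d when      *)
(* D a_h = a_(h-d).                                                            *)
Lemma log_coef_deriv (b : nat -> K) d : (0 < d)%N -> (0 < k)%N ->
  (forall h, (0 < h <= k)%N -> b h = if (d <= h)%N then a (h - d) else 0) ->
  \sum_(s <- parts k) (multfact s)^-1 *
     ((-1) ^+ (size s).-1 * (size s).-1`!%:R *
        \sum_(x <- s) b x * mon (rem x s)) = (d == k)%:R.
Proof.
move=> d0 k0 hb.
(* With one of l parts removed, l - 1 remain, so the weight (-1)^(l-1) (l-1)! of the logarithm is
   the weight of [inv_coef] on the rest. *)
pose G h s := b h * ((-1) ^+ size s * (size s)`!%:R * mon s).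
transitivity (\sum_(s <- parts k) (multfact s)^-1 * (\sum_(x <- s) G x (rem x s))).
  apply: eq_bigr => s _; congr (_ * _); rewrite big_distrr /=.
  apply: eq_big_seq => x xs; rewrite /G size_rem //; ring.
rewrite sum_parts_marked //.
transitivity (\sum_(1 <= h < k.+1) b h * inv_coef (k - h)).
  apply: eq_bigr => h _; rewrite /inv_coef big_distrr /=; apply: eq_bigr => s _.
  rewrite /G; ring.
case: (leqP d k) => dk; last first.
  rewrite big_nat big1 => [|h /andP[h0 hk]]; first by rewrite gtn_eqF.
  by rewrite hb ?h0 // ifN ?mul0r // -ltnNge (leq_trans hk).
(* The terms with h < d vanish; shifting h by d leaves the convolution of [a] with its inverse at
   index k - d. *)
rewrite (@big_cat_nat _ _ _ d) //=; last exact: leqW.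
rewrite [X in X + _]big_nat [X in X + _]big1 => [|h /andP[h0 hd]]; last first.
  by rewrite hb ?ifN ?mul0r -?ltnNge // h0 ltnW // (leq_trans hd).
rewrite add0r -{1}[d]add0n big_addn subSn //.
transitivity (\sum_(0 <= h < (k - d).+1) a h * inv_coef (k - d - h)).
  apply: eq_big_nat => h /andP[_ hk].
  by rewrite hb ?leq_addl ?addnK ?[(h + d)%N]addnC ?subnDA //; lia.
rewrite conv_inv_coef ?leq_subr // subn_eq0; congr (_%:R); congr nat_of_bool.
by rewrite eqn_leq dk.
Qed.

End PartitionSums.

(** * Elementary symmetric functions and Lagrange interpolation *)

(** Generating polynomial of the elementary symmetric functions of the y_j with j in [S]. *)
Definition prod_lin (A : comNzRingType) (T : finType) (y : T -> A) (S : {set T}) : {poly A} :=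
  \prod_(j in S) (1 + (y j)%:P * 'X).

Lemma coef_prod_lin (A : comNzRingType) (T : finType) (y : T -> A) (S : {set T}) m :
  (prod_lin y S)`_m =
    \sum_(U : {set T} | (U \subset S) && (#|U| == m)) \prod_(j in U) y j.
Proof.
have -> : prod_lin y S = \prod_j ((if j \in S then (y j)%:P * 'X else 0) + 1).
  rewrite /prod_lin big_mkcond; apply: eq_bigr => j _.
  by case: ifP => _; rewrite ?add0r // addrC.
rewrite bigA_distr coef_sum [RHS]big_mkcond; apply: eq_bigr => U _ /=.
case: (boolP (U \subset S)) => [/subsetP US | /subsetPn[j jU jS]] /=; last first.
  by rewrite (bigD1 j) //= jU (negbTE jS) mul0r coef0.
rewrite -big_mkcond /= (eq_bigr (fun j => (y j)%:P * 'X)) => [|j jU];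
  last by rewrite (US _ jU).
rewrite big_split /= prodr_const -rmorph_prod coefCM coefXn.
by rewrite eq_sym; case: ifP; rewrite ?mulr1 ?mulr0.
Qed.

(* Each I contributes the elementary symmetric function of its complement, and *)
(* a given U of size m avoids C(n - m, d) sets I of size d.                    *)
Lemma sum_coef_prod_linC (A : comNzRingType) (T : finType) (y : T -> A) d m :
  \sum_(I : {set T} | #|I| == d) (prod_lin y (~: I))`_m =
    'C(#|T| - m, d)%:R * (prod_lin y setT)`_m.
Proof.
under eq_bigr do rewrite coef_prod_lin.
rewrite (exchange_big_dep (fun U : {set T} => #|U| == m)) /=; last by move=> ? ? _ /andP[].
rewrite coef_prod_lin big_distrr /=.
apply: eq_big => [U | U /eqP Um]; first by rewrite subsetT.
rewrite sumr_const -[LHS]mulr_natl; congr (_%:R * _).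
rewrite -Um -(cardsC U) addKn -(cards_draws (~: U)) -cardsE; apply: eq_card => I.
by rewrite !inE unfold_in eqxx andbT andbC subsetC.
Qed.

Lemma size_1addZX (K : fieldType) (a : K) : (size (1 + a%:P * 'X)%R <= 2)%N.
Proof.
rewrite (leq_trans (size_polyD _ _)) // geq_max size_poly1.
by rewrite mul_polyC (leq_trans (size_scale_leq _ _)) ?size_polyX.
Qed.

(* Both sides have degree < #|I| and agree at the #|I| points - (y m)^-1.      *)
Lemma lagrange_prod_lin (K : fieldType) (T : finType) (y : T -> K) (I : {set T}) :
  injective y -> (forall j, y j != 0) -> (0 < #|I|)%N ->
  \sum_(i in I) (\prod_(j in I | j != i) (y j - y i))^-1 *: prod_lin y (I :\ i)
    = 'X^(#|I|.-1).
Proof.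
move=> y_inj y0 I0; apply/eqP; rewrite -subr_eq0.
set p := _ - _; apply/negPn/negP => p0.
have sp : (size p <= #|I|)%N.
  rewrite (leq_trans (size_polyD _ _)) // size_polyN size_polyXn prednK // geq_max leqnn andbT.
  rewrite (leq_trans (size_sum _ _ _)) //; apply/bigmax_leqP => i iI.
  rewrite (leq_trans (size_scale_leq _ _)) // (leq_trans (size_poly_prod_leq _ _)) //.
  rewrite leq_subLR (cardsD1 i I) iI.
  have: (\sum_(j in I :\ i) size (1 + (y j)%:P * 'X)%R <= \sum_(j in I :\ i) 2)%N.
    by apply: leq_sum => j _; apply: size_1addZX.
  rewrite sum_nat_const add1n -[X in (_ < X + _)%N]/#|I :\ i| => H.
  by rewrite addnS ltnS (leq_trans H) // muln2 addnn.
have := @max_poly_roots _ p [seq - (y m)^-1 | m in I] p0.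
rewrite size_map -cardE ltnNge sp /=.
suff -> : all (root p) [seq - (y m)^-1 | m in I].
  move=> /(_ isT); rewrite map_inj_uniq ?enum_uniq; first by move=> /(_ isT).
  by move=> i j /oppr_inj /invr_inj /y_inj.
apply/allP => _ /imageP[m mI ->].
(* At - 1/y_m every summand with i <> m contains the factor 1 + y_m t, which vanishes there. *)
rewrite /root /p hornerD hornerN hornerXn horner_sum (bigD1 m) //=
  [X in _ + X - _]big1 ?addr0 => [|i /andP[iI im]]; last first.
  have mIi : m \in I :\ i by rewrite !inE eq_sym im.
  rewrite hornerZ /prod_lin horner_prod (bigD1 m mIi) /= hornerD hornerMX !hornerC.
  by rewrite mulrN mulfV // subrr mul0r mulr0.
have Pm : \prod_(j in I | j != m) (y j - y m) != 0.
  by apply/prodf_neq0 => j /andP[_]; apply: contra; rewrite subr_eq0 => /eqP/y_inj ->.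
rewrite hornerZ /prod_lin horner_prod; apply/eqP/(canLR (addrK _)); rewrite add0r.
(* For each j <> m, 1 - y_j/y_m = (y_j - y_m) (- 1/y_m); these #|I| - 1 factors produce the power of
   the point. *)
apply: (mulfI Pm); rewrite mulrA mulfV // mul1r.
rewrite (cardsD1 m I) mI /= -prodr_const.
rewrite [X in _ = X * _](eq_bigl (mem (I :\ m))) => [|j]; last by rewrite !inE andbC.
rewrite -big_split /=; apply: eq_bigr => j _.
rewrite hornerD hornerMX !hornerC.
field; exact: y0.
Qed.

(** * The operators on the elementary invariants *)

Section Operators.
Variables (R : realType) (n r : nat).
Hypothesis r_gt0 : (0 < r)%N.
Local Notation C := R[i].
Local Notation poly_n := {mpoly C[n]}.
Local Notation rat_n := {fraction {mpoly C[n]}}.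
Implicit Types (i j : 'I_n) (p q : poly_n).

Definition scalar_frac (c : C) : rat_n := tofrac c%:MP.

HB.instance Definition _ := GRing.RMorphism.copy scalar_frac
  ((@tofrac poly_n) \o (@mpolyC n C)).

Lemma tofracZ c p : tofrac (c *: p) = scalar_frac c * tofrac p.
Proof. by rewrite -mul_mpolyC tofracM. Qed.

Lemma pchar_rat_n : [pchar rat_n] =i pred0.
Proof. by move=> p; rewrite (fmorph_pchar scalar_frac) pchar_num. Qed.

Lemma natrC_neq0 m : (0 < m)%N -> m%:R != 0 :> C.
Proof. by move=> m0; rewrite pnatr_eq0 -lt0n. Qed.

Lemma Xi_neq0 i : 'X_i != 0 :> poly_n.
Proof.
by apply/eqP => /(congr1 (mcoeff U_(i)%MM))/eqP; rewrite mcoeffX eqxx mcoeff0 oner_eq0.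
Qed.

Definition ypow i : rat_n := tofrac ('X_i ^+ r).

Lemma ypow_inj : injective ypow.
Proof.
move=> i j /eqP; rewrite tofrac_eq !mpolyXn => /eqP/(congr1 (mcoeff (U_(i) *+ r)%MM)).
rewrite !mcoeffX eqxx; case: eqP => [/(congr1 (fun m : 'X_{1.. n} => m i))|_ /eqP];
  last by rewrite oner_eq0.
by rewrite !mulmnE !mnm1E eqxx mul1n; case: eqP => [-> //|_]; case: (r) r_gt0.
Qed.

Lemma ypow_neq0 i : ypow i != 0.
Proof. by rewrite tofrac_eq0 expf_neq0 // Xi_neq0. Qed.

Lemma Delta_denom_neq0 i : tofrac (r%:R * 'X_i ^+ r.-1 : poly_n) != 0.
Proof.
rewrite tofrac_eq0 mulf_neq0 ?expf_neq0 ?Xi_neq0 //.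
by rewrite -mpolyC_nat mpolyC_eq0 natrC_neq0.
Qed.

Lemma Delta_eq0 i p : Delta r i p = 0 -> p^`M(i) = 0.
Proof.
move/eqP; rewrite mulf_eq0 invr_eq0 (negbTE (Delta_denom_neq0 i)) orbF.
by rewrite tofrac_eq0 => /eqP.
Qed.

Lemma Delta_is_zmod_morphism i : zmod_morphism (@Delta R n r i).
Proof. by move=> p q; rewrite /Delta mderivB tofracB mulrBl. Qed.

Lemma DeltaZ i c p : Delta r i (c *: p) = scalar_frac c * Delta r i p.
Proof. by rewrite /Delta mderivZ tofracZ mulrA. Qed.

Lemma DeltaM i p q :
  Delta r i (p * q) = Delta r i p * tofrac q + tofrac p * Delta r i q.
Proof. by rewrite /Delta mderivM tofracD !tofracM mulrDl mulrAC mulrA. Qed.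

(** Collecting the sets I that contain i exhibits D_d as a combination of the Delta_i, hence as a
    derivation, and supplies the matrix inverted for uniqueness. *)
Definition D_coef d i : rat_n :=
  d`!%:R * \sum_(I : {set 'I_n} | (#|I| == d) && (i \in I))
     (\prod_(j in I | j != i) tofrac ('X_j ^+ r - 'X_i ^+ r))^-1.

Lemma D_opE d p : D_op r d p = \sum_i D_coef d i * Delta r i p.
Proof.
rewrite /D_op /D_set (exchange_big_dep predT) //= big_distrr /=; apply: eq_bigr => i _.
by rewrite /D_coef -mulrA big_distrl.
Qed.

Lemma D_op_is_zmod_morphism d : zmod_morphism (@D_op R n r d).
Proof.
move=> p q; rewrite !D_opE -sumrB; apply: eq_bigr => i _.
by rewrite Delta_is_zmod_morphism mulrBr.
Qed.

HB.instance Definition _ d := GRing.isZmodMorphism.Build poly_n rat_n (@D_op R n r d)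
  (D_op_is_zmod_morphism d).

Lemma D_opZ d c p : D_op r d (c *: p) = scalar_frac c * D_op r d p.
Proof.
rewrite !D_opE big_distrr /=; apply: eq_bigr => i _; rewrite DeltaZ; ring.
Qed.

Lemma D_opM d p q :
  D_op r d (p * q) = D_op r d p * tofrac q + tofrac p * D_op r d q.
Proof.
rewrite !D_opE big_distrr big_distrl -big_split /=; apply: eq_bigr => i _.
rewrite DeltaM; ring.
Qed.

Lemma D_op1 d : @D_op R n r d 1 = 0.
Proof.
have := D_opM d 1 1; rewrite mulr1 tofrac1 mulr1 mul1r => /eqP.
by rewrite -subr_eq subrr => /eqP/esym.
Qed.

Lemma D_op_prod_seq d (a : nat -> poly_n) s :
  D_op r d (\prod_(x <- s) a x) =
    \sum_(x <- s) D_op r d (a x) * \prod_(h <- rem x s) tofrac (a h).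
Proof.
elim: s => [|x s IH]; first by rewrite !big_nil D_op1.
rewrite !big_cons D_opM IH rmorph_prod /= eqxx big_distrr /=; congr (_ + _).
apply: eq_big_seq => h hs; case: eqP => [->|_]; rewrite ?big_cons; last by ring.
by rewrite (perm_big _ (perm_to_rem hs)) big_cons /= mulrCA.
Qed.

Lemma Edef h : E R n r h = (prod_lin (fun i => 'X_i ^+ r : poly_n) setT)`_h.
Proof.
rewrite coef_prod_lin /E mesymE raddf_sum /=.
apply: eq_big => [S|S _]; first by rewrite subsetT.
rewrite mpolyXE_id rmorph_prod [RHS]big_mkcond /=; apply: eq_bigr => i _.
rewrite rmorphXn /= comp_mpolyXU mnmE -tnth_nth tnth_mktuple.
by case: (i \in S).
Qed.

Lemma mderiv_Xr i : ('X_i ^+ r : poly_n)^`M(i) = r%:R * 'X_i ^+ r.-1.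
Proof.
rewrite !mpolyXn mderivX mulmnE mnm1E eqxx mul1n -mul_mpolyC mpolyC_nat.
congr (_ * 'X_[_]); apply/mnmP => j; rewrite mnmBE !mulmnE !mnm1E.
by case: eqP => _; rewrite ?mul1n ?mul0n // subn1.
Qed.

Lemma mderiv_Xr_neq i j : j != i -> ('X_j ^+ r : poly_n)^`M(i) = 0.
Proof. by move=> ji; rewrite !mpolyXn mderivX mulmnE mnm1E (negbTE ji) scale0r. Qed.

Lemma mderiv_prod_lin i (S : {set 'I_n}) m : i \notin S ->
  ((prod_lin (fun i => 'X_i ^+ r : poly_n) S)`_m)^`M(i) = 0.
Proof.
move=> iS; rewrite coef_prod_lin raddf_sum /= big1 // => U /andP[/subsetP US _].
apply: (@big_rec _ (fun p => p^`M(i) = 0)) => [|j p jU p0]; first by rewrite -mpolyC1 mderivC.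
rewrite mderivM p0 mulr0 addr0 mderiv_Xr_neq ?mul0r //.
by apply: contraNneq iS => <-; apply: US.
Qed.

Lemma tofrac_coef_prod_lin (S : {set 'I_n}) m :
  tofrac (prod_lin (fun i => 'X_i ^+ r : poly_n) S)`_m = (prod_lin ypow S)`_m.
Proof.
rewrite !coef_prod_lin raddf_sum; apply: eq_bigr => U _; exact: rmorph_prod.
Qed.

(** In prod_j (1 + y_j t) only the factor 1 + y_i t depends on x_i, and Delta_i y_i = 1 turns it
    into t. *)
Lemma Delta_E i h : Delta r i (E R n r h) = ('X * prod_lin ypow [set~ i])`_h.
Proof.
rewrite Edef /prod_lin (bigD1 i) //= mulrDl mul1r -mulrA coefD coefCM.
rewrite (eq_bigl (mem [set~ i])) => [|j]; last by rewrite !inE.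
rewrite -/(prod_lin _ _) /Delta mderivD mderivM mderiv_Xr !coefXM.
rewrite mderiv_prod_lin ?inE ?eqxx // add0r.
case: ifP => _; first by rewrite !(mulr0, mderiv0, add0r) tofrac0 mul0r.
rewrite mderiv_prod_lin ?inE ?eqxx // mulr0 addr0 tofracM tofrac_coef_prod_lin.
by rewrite mulrAC (mulfV (Delta_denom_neq0 i)) mul1r.
Qed.

(** The product over j <> i splits into I minus i and the complement of I; the latter is common to
    all i, and Lagrange interpolation sums the former. *)
Lemma D_set_E (I : {set 'I_n}) h : (0 < #|I|)%N ->
  D_set r I (E R n r h) = ('X^#|I| * prod_lin ypow (~: I))`_h.
Proof.
move=> I0; rewrite -(prednK I0) exprS -mulrA -(lagrange_prod_lin ypow_inj ypow_neq0 I0).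
rewrite big_distrl big_distrr coef_sum /D_set; apply: eq_bigr => i iI /=.
under eq_bigr do rewrite tofracB.
rewrite Delta_E -scalerAl -scalerAr coefZ; congr (_ * nth 0 (polyseq _) h); congr (_ * _).
rewrite /prod_lin (bigID (mem I)) /=; congr (_ * _); apply: eq_bigl => j; rewrite !inE //.
by case: eqP => [->|_]; rewrite ?iI.
Qed.

Lemma D_op_E d h : (0 < d)%N -> D_op r d (E R n r h) =
  if (d <= h)%N then (d`! * 'C(n - (h - d), d))%:R * tofrac (E R n r (h - d)) else 0.
Proof.
move=> d0; transitivity (d`!%:R * \sum_(I : {set 'I_n} | #|I| == d)
    ('X^d * prod_lin ypow (~: I))`_h).
  congr (_ * _); apply: eq_bigr => I /eqP Id; rewrite D_set_E Id //.
under eq_bigr do rewrite coefXnM.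
case: leqP => hd; last by rewrite big1 ?mulr0.
by rewrite sum_coef_prod_linC card_ord mulrA -natrM Edef tofrac_coef_prod_lin.
Qed.

Lemma Etilde0 : Etilde R n r 0 = 1.
Proof.
rewrite /Etilde subn0 divff ?natrC_neq0 ?fact_gt0 // scale1r Edef.
by rewrite /prod_lin coef0_prod big1 // => i _; rewrite coefD coef1 coefMX addr0.
Qed.

(** The normalisation absorbs the count: d! C(n-h+d, d) (n-h)! = (n-h+d)! for d <= h <= n. *)
Lemma D_op_Etilde d h : (0 < d)%N -> (h <= n)%N -> D_op r d (Etilde R n r h) =
  if (d <= h)%N then tofrac (Etilde R n r (h - d)) else 0.
Proof.
move=> d0 hn; rewrite /Etilde D_opZ D_op_E //; case: ifP => dh; last by rewrite mulr0.
rewrite tofracZ mulrA; congr (_ * _).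
rewrite -[X in _ * X](rmorph_nat scalar_frac) -rmorphM /=; congr scalar_frac.
rewrite mulrAC -natrM; congr (_%:R / _).
have hd : (d <= n - (h - d))%N by lia.
rewrite -(bin_fact hd) (_ : n - (h - d) - d = n - h)%N; last by lia.
by rewrite mulnA mulnC (mulnC _ d`!).
Qed.

End Operators.

(** * The logarithm formula and uniqueness *)

Section Formula.
Variables (R : realType) (n r k : nat).
Hypotheses (r_gt0 : (0 < r)%N) (k_bounds : (0 < k <= n)%N).
Local Notation C := R[i].
Local Notation poly_n := {mpoly C[n]}.
Local Notation rat_n := {fraction {mpoly C[n]}}.

Lemma U_formulaE : U_formula R n r k = \sum_(s <- parts k)
  ((-1) ^+ (size s).-1 * (size s).-1`!%:R / multfact C k s)
     *: \prod_(x <- s) Etilde R n r x.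
Proof.
rewrite /parts big_map big_filter big_enum_cond /= /U_formula.
apply: eq_big => [l // | l pl]; rewrite size_map; congr (_ *: _).
rewrite (big_seq_count _ _ (fun x => is_partition_mem pl)).
by apply: eq_bigr => h _; rewrite iter_mulr_1.
Qed.

Lemma D_op_U_formula d : (0 < d <= n)%N -> D_op r d (U_formula R n r k) = (d == k)%:R.
Proof.
case/andP: k_bounds => k0 kn /andP[d0 dn].
rewrite -(log_coef_deriv (k := k) (pchar_rat_n R n) (a := fun h => tofrac (Etilde R n r h))
  _ (b := fun h => D_op r d (Etilde R n r h)) d0 k0); last first.
- by move=> h /andP[_ hk]; rewrite D_op_Etilde // (leq_trans hk).
- by rewrite Etilde0 tofrac1.
rewrite U_formulaE raddf_sum; apply: eq_bigr => s _ /=.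
rewrite D_opZ D_op_prod_seq mulrA; congr (_ * _).
rewrite fmorph_div /= rmorphM rmorph_sign rmorph_nat mulrC; congr (_^-1 * _).
by rewrite /multfact rmorph_prod; apply: eq_bigr => h _; apply: rmorph_nat.
Qed.

Lemma E_homog h : E R n r h \is (r * h)%N.-homog.
Proof.
rewrite Edef coef_prod_lin rpred_sum // => S /andP[_ /eqP <-].
rewrite -sum1_card big_distrr /=; elim/big_rec2: _ => [|i d p _ hp]; first exact: dhomog1.
apply: dhomogM => //; rewrite mpolyXn dhomogX /= mdegMn mdeg1 mul1n muln1 //.
Qed.

Lemma U_formula_homog : U_formula R n r k \is (r * k)%N.-homog.
Proof.
rewrite U_formulaE big_seq rpred_sum // => s.
rewrite mem_parts => /is_partition_sumn <-; apply: dhomogZ.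
elim: s => [|x s IH]; first by rewrite big_nil muln0; apply: dhomog1.
rewrite big_cons /= mulnDr; apply: dhomogM => //; exact/dhomogZ/E_homog.
Qed.

Lemma E_invariant h : Grn_invariant r (E R n r h).
Proof.
move=> z s z1 x.
have ev v : (E R n r h).@[v] = (prod_lin (fun i => v i ^+ r) setT)`_h.
  rewrite Edef !coef_prod_lin raddf_sum; apply: eq_bigr => S _ /=.
  by rewrite rmorph_prod; apply: eq_bigr => i _; rewrite rmorphXn /= mevalXU.
rewrite !ev; congr (nth 0 (polyseq _) h).
rewrite /prod_lin [RHS](reindex_inj (@perm_inj _ (s^-1)%g)).
apply: eq_big => [i|i _]; first by rewrite !inE.
by move: (z1 i); rewrite /Grn_act exprMn unity_rootE => /eqP ->; rewrite mul1r.
Qed.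

Lemma U_formula_invariant : Grn_invariant r (U_formula R n r k).
Proof.
move=> z s z1 x; rewrite U_formulaE !raddf_sum; apply: eq_bigr => l _ /=.
rewrite !mevalZ !rmorph_prod; congr (_ * _); apply: eq_bigr => h _ /=.
by rewrite !mevalZ (@E_invariant h z s z1).
Qed.

Lemma is_U_U_formula : is_U r k (U_formula R n r k).
Proof.
by split; [exact: U_formula_invariant | exact: U_formula_homog | exact: D_op_U_formula].
Qed.

End Formula.

(** The product M J is triangular with unit diagonal, so its determinant is 1 and the square matrix
    [M] is invertible. *)
Lemma unitriangular_factor_inj (K : fieldType) n (M J : 'I_n -> 'I_n -> K) (v : 'I_n -> K) :
  (forall d h : 'I_n, (h < d)%N -> \sum_i M d i * J i h = 0) ->
  (forall d, \sum_i M d i * J i d = 1) ->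
  (forall d, \sum_i M d i * v i = 0) -> forall i, v i = 0.
Proof.
move=> MJ0 MJ1 Mv i; pose A := \matrix_(d, l) M d l; pose B := \matrix_(l, h) J l h.
have AB d h : (A *m B) d h = \sum_l M d l * J l h.
  by rewrite mxE; apply: eq_bigr => l _; rewrite !mxE.
have : A *m B \in unitmx.
  rewrite unitmxE -det_tr det_trig; last first.
    by apply/is_trig_mxP => l j lj; rewrite mxE AB MJ0.
  by rewrite big1 ?unitr1 // => l _; rewrite mxE AB MJ1.
rewrite unitmx_mul => /andP[uA _].
have Av0 : A *m \col_l v l = 0.
  apply/matrixP => d j; rewrite !mxE -[RHS](Mv d).
  by apply: eq_bigr => l _; rewrite !mxE.
suff /matrixP/(_ i 0) : \col_l v l = 0 by rewrite !mxE.
by rewrite -(mulKmx uA (\col_l v l)) Av0 mulmx0.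
Qed.

Section Uniqueness.
Variables (R : realType) (n r : nat).
Hypothesis r_gt0 : (0 < r)%N.
Local Notation poly_n := {mpoly R[i][n]}.
Local Notation rat_n := {fraction {mpoly R[i][n]}}.

(* The matrix of the D_d in terms of the Delta_i is invertible, because its    *)
(* product with the matrix (Delta_i Etilde_h) is (D_d Etilde_h), which is      *)
(* unitriangular.                                                              *)
Lemma D_op_eq0_Delta (p : poly_n) :
  (forall d, (0 < d <= n)%N -> D_op r d p = 0) -> forall i, Delta r i p = 0.
Proof.
move=> Dp.
(* Ordinals start at 0, hence the shifts [d.+1] and [h.+1]; the diagonal entries are Etilde_0 =
   1. *)
apply: (@unitriangular_factor_inj _ n (fun d i => D_coef R r d.+1 i)
  (fun i h => Delta r i (Etilde R n r h.+1))) => [d h hd|d|d].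
- by rewrite -D_opE D_op_Etilde ?ltn_ord // ltnS leqNgt hd.
- by rewrite -D_opE D_op_Etilde ?ltn_ord // leqnn subnn Etilde0 tofrac1.
- by rewrite -D_opE; apply: Dp; apply: ltn_ord.
Qed.

(** If m_i > 0, the coefficient at m reappears in the derivative along x_i multiplied by m_i,
    nonzero in characteristic 0; the constant term vanishes because d > 0. *)
Lemma homog_mderiv_eq0 (p : poly_n) d :
  (0 < d)%N -> p \is d.-homog -> (forall i, p^`M(i) = 0) -> p = 0.
Proof.
move=> d0 hp dp; apply/mpolyP => m; rewrite mcoeff0.
have [m0|[i mi]] : m = 0%MM \/ exists i, m i != 0%N.
  case: (boolP [exists i, m i != 0%N]) => [/existsP|/existsPn m0]; [by right|left].
  by apply/mnmP => i; rewrite mnm0E; apply/eqP/negPn.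
  by apply: (dhomog_nemf_coeff hp); rewrite m0 /= mdeg0 eq_sym -lt0n.
have := congr1 (mcoeff (m - U_(i))%MM) (dp i); rewrite mcoeff_mderiv mcoeff0.
rewrite submK ?lep1mP // => /eqP; rewrite -mulr_natr mulf_eq0 pnatr_eq0 orbF.
by move/eqP.
Qed.

Lemma is_U_unique k (p q : poly_n) : (0 < k)%N -> is_U r k p -> is_U r k q -> p = q.
Proof.
move=> k0 [_ hp Dp] [_ hq Dq]; apply/eqP; rewrite -subr_eq0; apply/eqP.
apply: (@homog_mderiv_eq0 _ (r * k)); rewrite ?muln_gt0 ?r_gt0 ?rpredB // => i.
apply: (Delta_eq0 r_gt0); apply: D_op_eq0_Delta => d dn.
by rewrite raddfB /= Dp ?Dq ?subrr.
Qed.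

End Uniqueness.

Theorem theorem5p6 (R : realType) (n r k : nat)
    (hn : (1 <= n)%N) (hr : (1 <= r)%N) (hk : (1 <= k <= n)%N) :
  (exists! U : {mpoly R[i][n]}, is_U r k U) /\
  is_U r k (U_formula R n r k).
Proof.
have isU := is_U_U_formula R hr hk; split => //.
exists (U_formula R n r k); split=> // p; apply: is_U_unique => //.
by case/andP: hk.
Qed.
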